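(* Suppose $X$ is a compact Hausdorff space. Then the following are equivalent: (1) $X$ is a $\upsilon$-space. (2) $X$ is a real $\eta$-space. (3) The set of $\mathfrak{q}$-points of $X$ is dense in $X$. (4) $X$ has no isolated points.
   Context: $C_R(X)$ denotes the algebra of real-valued continuous functions on $X$. A map $T$ on $C_R(X)$ is additive if $T(f+g)=T(f)+T(g)$ for all $f,g$; it is a multiplication if there is $a\in C_R(X)$ with $T(f)=af$ for all $f\in C_R(X)$ (then $a=T(1)$); it is a local multiplication if for each $f\in C_R(X)$ there is $a_f\in C_R(X)$ with $T(f)=a_f f$; it is zero-preserving if for every $f\in C_R(X)$ and every $x\in X$, $f(x)=0$ implies $T(f)(x)=0$. A compact Hausdorff space $X$ is a $\upsilon$-space if every additive zero-preserving map on $C_R(X)$ is a multiplication. It is a real $\eta$-space if every additive local multiplication on $C_R(X)$ is a multiplication. A point $x\in X$ is a $\mathfrak{q}$-point of $X$ if there is a sequence $\{K_n\}_{n\in\mathbb{N}}$ of pairwise disjoint compact subsets of $X$ such that each $K_n$ is disjoint from the closure of $\bigcup_{m\in\mathbb{N},\,m\neq n}K_m$, and $x\in \overline{\bigcup_{n\in\mathbb{N}}K_n}\setminus\bigcup_{n\in\mathbb{N}}K_n$. *)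

(* Defs.v *)
From HB Require Import structures.
From mathcomp Require Import all_boot all_order all_algebra.
From mathcomp Require Import all_classical all_reals all_analysis.
Set Implicit Arguments.
Unset Strict Implicit.
Unset Printing Implicit Defensive.
Import Order.TTheory GRing.Theory Num.Theory.
Import numFieldNormedType.Exports.
Local Open Scope classical_set_scope.
Local Open Scope ring_scope.

(* continuousType X R with the pointwise operations.  It is only a comPzRingType: when
   X is empty, 0 = 1. *)
Section ContinuousRing.
Context {X : topologicalType} {R : realType}.
Implicit Types f g h : continuousType X R.

Local Lemma add_cts f g : continuous (fun x => f x + g x).
Proof. by move=> x; apply: (@continuousD R R^o); exact: cts_fun. Qed.

Local Lemma opp_cts f : continuous (fun x => - f x).
Proof. by move=> x; apply: (@continuousN R R^o); exact: cts_fun. Qed.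

Local Lemma mul_cts f g : continuous (fun x => f x * g x).
Proof. by move=> x; apply: continuousM; exact: cts_fun. Qed.

Definition cfun_zero : continuousType X R := cst 0.
Definition cfun_one : continuousType X R := cst 1.
Definition cfun_add f g : continuousType X R := mkcts (@add_cts f g).
Definition cfun_opp f : continuousType X R := mkcts (@opp_cts f).
Definition cfun_mul f g : continuousType X R := mkcts (@mul_cts f g).

Local Lemma cfun_addA : associative cfun_add.
Proof. by move=> f g h; apply/continuousEP => x; exact: addrA. Qed.
Local Lemma cfun_addC : commutative cfun_add.
Proof. by move=> f g; apply/continuousEP => x; exact: addrC. Qed.
Local Lemma cfun_add0 : left_id cfun_zero cfun_add.
Proof. by move=> f; apply/continuousEP => x; exact: add0r. Qed.
Local Lemma cfun_addN : left_inverse cfun_zero cfun_opp cfun_add.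
Proof. by move=> f; apply/continuousEP => x; exact: addNr. Qed.

HB.instance Definition _ := GRing.isZmodule.Build (continuousType X R)
  cfun_addA cfun_addC cfun_add0 cfun_addN.

Local Lemma cfun_mulA : associative cfun_mul.
Proof. by move=> f g h; apply/continuousEP => x; exact: mulrA. Qed.
Local Lemma cfun_mulC : commutative cfun_mul.
Proof. by move=> f g; apply/continuousEP => x; exact: mulrC. Qed.
Local Lemma cfun_mul1 : left_id cfun_one cfun_mul.
Proof. by move=> f; apply/continuousEP => x; exact: mul1r. Qed.
Local Lemma cfun_mulD : left_distributive cfun_mul cfun_add.
Proof. by move=> f g h; apply/continuousEP => x; exact: mulrDl. Qed.

HB.instance Definition _ := GRing.Zmodule_isComPzRing.Build (continuousType X R)
  cfun_mulA cfun_mulC cfun_mul1 cfun_mulD.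

Lemma cfunDE f g x : (f + g) x = f x + g x. Proof. by []. Qed.
Lemma cfunNE f x : (- f) x = - f x. Proof. by []. Qed.
Lemma cfunME f g x : (f * g) x = f x * g x. Proof. by []. Qed.
Lemma cfun0E x : (0 : continuousType X R) x = 0. Proof. by []. Qed.
Lemma cfun1E x : (1 : continuousType X R) x = 1. Proof. by []. Qed.

End ContinuousRing.

Section Maps.
Context {R : realType} {X : topologicalType}.
Implicit Type T : continuousType X R -> continuousType X R.

Definition additive_map T := forall f g : continuousType X R, T (f + g) = T f + T g.

Definition multiplication T :=
  exists a : continuousType X R, forall f : continuousType X R, T f = a * f.

Definition local_multiplication T :=
  forall f : continuousType X R, exists a : continuousType X R, T f = a * f.

Definition zero_preserving T :=
  forall (f : continuousType X R) (x : X), f x = 0 -> T f x = 0.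

End Maps.

(* Compactness and the Hausdorff property are not part of the definitions of
   upsilon- and real eta-spaces below: they are assumed wherever these are
   used. *)
Definition upsilon_space (R : realType) (X : topologicalType) :=
  forall T : continuousType X R -> continuousType X R,
    additive_map T -> zero_preserving T -> multiplication T.

Definition real_eta_space (R : realType) (X : topologicalType) :=
  forall T : continuousType X R -> continuousType X R,
    additive_map T -> local_multiplication T -> multiplication T.

Definition q_point (X : topologicalType) (x : X) :=
  exists K : nat -> set X,
    [/\ forall n, compact (K n),
        trivIset [set: nat] K,
        forall n, K n `&` closure (\bigcup_(m in [set m | m <> n]) K m) = set0
      & (closure (\bigcup_n K n) `\` \bigcup_n K n) x].

(* Main.v *)
Require Import Defs.
From HB Require Import structures.
From mathcomp Require Import all_boot all_order all_algebra.
From mathcomp Require Import ring lra.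
From mathcomp Require Import all_classical all_reals all_analysis.
Set Implicit Arguments.
Unset Strict Implicit.
Unset Printing Implicit Defensive.
Import Order.TTheory GRing.Theory Num.Theory.
Import numFieldNormedType.Exports.
Local Open Scope classical_set_scope.
Local Open Scope ring_scope.

(** The heart of the matter is that on a space without isolated points an
additive zero-preserving map T is automatically linear over the functions.
Zero-preservation makes T f x depend on the number f x alone, through an
additive function of that number.  After subtracting the multiplication by T 1
this additive function vanishes on the rationals; if it is not zero, it takes
arbitrarily large values at arbitrarily small arguments (scale by a large
integer, then subtract a nearby rational, [zero_preserving_spike]).  If this
happens at one point, for a given f, it happens on a nonempty open set, and a
nonempty open set without isolated points contains infinitely many points
x_n with pairwise disjoint open neighbourhoods ([disjoint_opens]).  Small bumps
around the x_n, with heights tending to 0, add up to one continuous function g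
([glue_disjoint_bumps]), and the heights can be chosen so that T g is unbounded
on the x_n, which is absurd on a compact space
([zero_preserving_killing1_eq0]).

The same sequence x_n, with its one-point sets as K_n, produces q-points: any
of its cluster points is one ([perfect_q_point_dense]).  Conversely an isolated
point is never a q-point, and a dense set contains all isolated points.

If x is isolated, a discontinuous additive function phi from R to R turns into
the map sending f to phi (f x) times the indicator of x; this is a local
multiplication which is not a multiplication ([real_eta_perfect]).  Here phi is
an additive retraction of R onto the rationals, which a maximality argument
provides ([additive_retraction_onto_rat]); it is not linear because pi is
irrational.

In the lemmas, the absence of isolated points is expressed by
[perfect_set [set: X]]. *)

(** * An additive retraction of the reals onto the rationals *)

Definition rat_subspace (R : numFieldType) (V : set R) :=
  forall q x y, V x -> V y -> V (ratr q * x + y).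

(** A Q-subspace V maximal among those that avoid 1 is a complement of the line Q:
adjoining any x outside V must catch 1, and solving for x puts it in V + Q. *)
Lemma rat_subspace_maximal_avoiding1 (R : numFieldType) :
  exists V : set R, [/\ rat_subspace V, V 0, ~ V 1 &
    forall x, exists q : rat, V (x - ratr q)].
Proof.
pose P : set (set R) := [set V | rat_subspace V /\ ~ V 1].
have [|V [[Vsub V1] Vmax]] := @Zorn_bigcup R P.
  move=> F FP Ftot; split=> [q x y [A FA Ax] [B FB By]|[A FA]].
    have [AB|BA] := Ftot _ _ FA FB.
      by exists B => //; apply: (FP _ FB).1 => //; exact: AB.
    by exists A => //; apply: (FP _ FA).1 => //; exact: BA.
  exact: (FP _ FA).2.
have V0 : V 0.
  apply: contrapT => nV0.
  (* rat_subspace holds of the empty set, so maximality against {0} is needed. *)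
  have V_empty x : ~ V x.
    move=> Vx; apply: nV0.
    by have := Vsub (-1) _ _ Vx Vx; rewrite rmorphN1 mulN1r addNr.
  apply: (Vmax [set 0]); first by split=> [x /V_empty//|/(_ 0 erefl)].
  split=> [q x y /= -> ->|/= /eqP]; first by rewrite mulr0 addr0.
  by rewrite oner_eq0.
exists V; split=> // x.
have VZ q y : V y -> V (ratr q * y) by move=> Vy; rewrite -[_ * _]addr0; exact: Vsub.
have [Vx|nVx] := pselect (V x); first by exists 0; rewrite rmorph0 subr0.
pose W : set R := [set z | exists q v, V v /\ z = ratr q * x + v].
have : W 1.
  apply: contrapT => nW1; apply: (Vmax W).
    split=> [v Vv|/(_ x)WV]; first by exists 0, v; rewrite rmorph0 mul0r add0r.
    by apply/nVx/WV; exists 1, 0; rewrite rmorph1 mul1r addr0.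
  split=> // q _ _ [r [v [Vv ->]]] [s [w [Vw ->]]].
  exists (q * r + s), (ratr q * v + w); split; first exact: Vsub.
  by rewrite rmorphD rmorphM mulrDl mulrDr -!mulrA addrACA.
move=> [q [v [Vv e1]]].
have q0 : q != 0.
  by apply: contra_notN V1 => /eqP q0; rewrite e1 q0 rmorph0 mul0r add0r.
have rq0 : ratr q != 0 :> R by rewrite fmorph_eq0.
exists q^-1; rewrite fmorphV.
suff -> : x - (ratr q)^-1 = ratr (- q^-1) * v by exact: VZ.
rewrite rmorphN fmorphV.
have -> : v = 1 - ratr q * x by rewrite e1 addrC addrA addNr add0r.
by rewrite mulrBr mulr1 !mulNr opprK mulKf // addrC.
Qed.

(** The projection onto Q along the complement V of the previous lemma. *)
Lemma additive_retraction_onto_rat (R : numFieldType) :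
  exists phi : R -> rat, {morph phi : x y / x + y} /\ phi 1 = 1.
Proof.
have [V [Vsub V0 V1 /choice[phi Vphi]]] := rat_subspace_maximal_avoiding1 R.
have phi_unique x q : V (x - ratr q) -> phi x = q.
  move=> Vq; apply/eqP; rewrite -subr_eq0; apply: contra_notT V1 => d0.
  have d0' : ratr (phi x - q) != 0 :> R by rewrite fmorph_eq0.
  have := Vsub (-1) _ _ (Vphi x) Vq.
  have -> : ratr (-1) * (x - ratr (phi x)) + (x - ratr q) = ratr (phi x - q).
    by rewrite rmorphN1 mulN1r opprB rmorphB addrA subrK.
  move=> Vd; have := Vsub (phi x - q)^-1 _ _ Vd V0.
  by rewrite fmorphV addr0 mulVf.
exists phi; split=> [x y|]; apply: phi_unique; last by rewrite rmorph1 subrr.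
have := Vsub 1 _ _ (Vphi x) (Vphi y).
by rewrite rmorph1 mul1r rmorphD opprD addrACA.
Qed.

(** * Sequences of disjoint open sets *)

(** A nonempty open set W contains two points, hence two disjoint nonempty open
sets: one serves as the next V n, and the construction continues inside the
other. *)
Lemma disjoint_opens (X : topologicalType) (U : set X) :
    hausdorff_space X -> perfect_set [set: X] -> open U -> U !=set0 ->
  exists (x : nat -> X) (V : nat -> set X),
    [/\ forall n, open (V n), forall n, V n `<=` U, forall n, V n (x n)
      & trivIset [set: nat] V].
Proof.
move=> hX /perfectTP_ex pX oU U0.
pose good (W : set X) := open W /\ W !=set0.
pose S := {W | good W}.
have split_open (W : S) : {xVW : X * set X * S |
    [/\ xVW.1.2 xVW.1.1, open xVW.1.2, xVW.1.2 `<=` sval W,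
        sval xVW.2 `<=` sval W & xVW.1.2 `&` sval xVW.2 = set0]}.
  apply: cid; case: W => W [/= oW W0].
  have [x [y [Wx Wy xy]]] := pX W oW W0.
  move: hX; rewrite open_hausdorff => /(_ x y xy)[[A B] /=].
  rewrite !inE => -[Ax By] [oA oB AB0].
  have BW0 : good (B `&` W).
    by split; [exact: openI|exists y].
  exists (x, A `&` W, exist good _ BW0); split=> //=.
  - exact: openI.
  - by apply/seteqP; split=> // z [[Az _] [Bz _]]; have : (A `&` B) z by []; rewrite AB0.
pose next W := (sval (split_open W)).2.
pose W n := iter n next (exist good U (conj oU U0)).
pose x n := (sval (split_open (W n))).1.1.
pose V n := (sval (split_open (W n))).1.2.
have VP n : [/\ V n (x n), open (V n), V n `<=` sval (W n),
    sval (W n.+1) `<=` sval (W n) & V n `&` sval (W n.+1) = set0].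
  exact: svalP (split_open (W n)).
have Wdecr m n : (m <= n)%N -> sval (W n) `<=` sval (W m).
  elim: n => [|n IH]; first by rewrite leqn0 => /eqP ->.
  rewrite leq_eqVlt => /predU1P[->//|mn].
  by case: (VP n) => _ _ _ WW _; exact: subset_trans WW (IH mn).
have Vdisj m n : (m < n)%N -> V m `&` V n = set0.
  move=> mn; case: (VP m) => _ _ _ _; case: (VP n) => _ _ VW _ _ VW0.
  apply/seteqP; split=> // z [Vm Vn]; rewrite -VW0.
  by split=> //; apply: (Wdecr _ _ mn); exact: VW.
exists x, V; split.
- by move=> n; case: (VP n).
- move=> n; case: (VP n) => _ _ VW _ _.
  by apply: subset_trans VW _; exact: (Wdecr 0%N n).
- by move=> n; case: (VP n).
- move=> m n _ _; have [mn|nm|->//] := ltngtP m n.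
    by rewrite Vdisj // => /set0P; rewrite eqxx.
  by rewrite setIC Vdisj // => /set0P; rewrite eqxx.
Qed.

(** The cluster point y differs from every x n because V n is a neighbourhood of
x n that the rest of the sequence never enters; and y stays in the closure of
W, which regularity places inside the given open set. *)
Lemma perfect_q_point_dense (X : topologicalType) :
    compact [set: X] -> hausdorff_space X -> perfect_set [set: X] ->
  dense [set x : X | q_point x].
Proof.
move=> cX hX pX O [p Op] oO.
have [W nW WO] : exists2 W, nbhs p W & closure W `<=` O.
  have pT : nbhs p [set: X] by exact: filterT.
  by apply: (compact_regular hX cX pT); exact: open_nbhs_nbhs.
have [x [V [oV VW Vx dV]]] : exists (x : nat -> X) (V : nat -> set X),
    [/\ forall n, open (V n), forall n, V n `<=` W°, forall n, V n (x n)
      & trivIset [set: nat] V].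
  apply: disjoint_opens => //; first exact: open_interior.
  by exists p; exact: nW.
have Vuniq m n z : V m z -> V n z -> m = n.
  by move=> Vm Vn; apply: dV => //; exists z.
have [y [_ xy]] : exists y, [set: X] y /\ cluster (x @ \oo) y.
  by apply: (cX (x @ \oo)); exact: filterT.
exists y; split.
  apply/WO => B nB.
  have [z [Vz Bz]] : range x `&` B !=set0.
    by apply: xy nB; exists 0%N => // n _; exists n.
  by exists z; split=> //; case: Vz => n _ <-; exact: interior_subset (VW n _ (Vx n)).
exists (fun n => [set x n]); split.
- by move=> n; exact: compact_set1.
- by move=> m n _ _ [z [/= -> e]]; apply: (Vuniq _ _ (x m)) => //; rewrite e.
- move=> n; apply/seteqP; split=> // z [/= -> {z}] cl.
  have [z [[m /= mn ->]]] := cl _ (open_nbhs_nbhs (conj (oV n) (Vx n))).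
  by move=> Vnm; apply: mn; exact: (Vuniq _ _ (x m)).
- split=> [B nB|[n _ /= yx]].
    have [z [[n _ <-] Bz]] : range x `&` B !=set0.
      by apply: xy nB; exists 0%N => // n _; exists n.
    by exists (x n); split=> //; exists n.
  (* V n would be a neighbourhood of y that x m enters for m = n only. *)
  have [z [[m /= nm <-] Vnm]] : (x @` [set m | (n < m)%N]) `&` V n !=set0.
    apply: xy; last by rewrite yx; exact: open_nbhs_nbhs.
    by exists n.+1 => // m /= nm; exists m.
  by move: nm; rewrite (Vuniq _ _ _ Vnm (Vx m)) ltnn.
Qed.

Lemma q_point_dense_perfect (X : topologicalType) :
  dense [set x : X | q_point x] -> perfect_set [set: X].
Proof.
move=> dX; apply/perfectTP => x ox.
have [_ [/= -> [K [_ _ _ [clK nK]]]]] := dX _ (ex_intro _ x erefl) ox.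
have [z [Kz /= zx]] := clK _ (open_nbhs_nbhs (conj ox erefl)).
by apply: nK; rewrite -zx.
Qed.

(** * Continuous functions with prescribed local behaviour *)

Section ContinuousFunctions.
Context {R : realType} {X : topologicalType}.
Local Notation C := (continuousType X R).

(** Evaluation at a point gets a name in order to carry an additive structure,
which makes finite sums and multiples of functions computable pointwise. *)
Definition cfun_eval (x : X) (f : continuousType X R) : R := f x.

Lemma cfun_eval_is_zmod_morphism x : zmod_morphism (cfun_eval x).
Proof. by []. Qed.
HB.instance Definition _ x := GRing.isZmodMorphism.Build (continuousType X R) R
  (cfun_eval x) (cfun_eval_is_zmod_morphism x).

Lemma bump (V : set X) x : normal_space X -> hausdorff_space X -> open V -> V x ->
  exists h : C, [/\ h x = 1, forall y, ~ V y -> h y = 0 & forall y, `|h y| <= 1].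
Proof.
move=> nX hX oV Vx.
have cx : closed [set x] by apply: accessible_closed_set1; exact: hausdorff_accessible.
have [|h [ch h0 h1 h01]] := urysohn_ext_itv nX (open_closedC oV) cx _ (@ltr01 R).
  by apply/seteqP; split=> // y [nV /= yx]; apply: nV; rewrite yx.
exists (mkcts ch); split => /=.
- by apply: h1; exists x.
- by move=> y nVy; apply: h0; exists y.
- move=> y; have := h01 (h y) (ex_intro2 _ _ y I erefl).
  by rewrite /= in_itv /= => /andP[h0' h1']; rewrite ger0_norm.
Qed.

(** The series of the u n is uniformly convergent: at each point at most one term
is nonzero, so truncating it after N terms costs at most 1 / (N + 1). *)
Lemma glue_disjoint_bumps (V : nat -> set X) (u : nat -> continuousType X R) :
    trivIset [set: nat] V ->
    (forall n y, ~ V n y -> u n y = 0) ->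
    (forall n y, `|u n y| <= n.+1%:R^-1) ->
  exists g : continuousType X R, forall n y, V n y -> g y = u n y.
Proof.
move=> dV u0 ub.
have Vuniq m n z : V m z -> V n z -> m = n.
  by move=> Vm Vn; apply: dV => //; exists z.
pose g y := if pselect (exists n, V n y) is left h then u (sval (cid h)) y else 0.
have gV n y : V n y -> g y = u n y.
  rewrite /g => Vny; case: pselect => [h|]; last by case; exists n.
  by case: cid => m /= Vmy; rewrite (Vuniq _ _ _ Vmy Vny).
have gN N y : `|(\sum_(n < N) u n) y - g y| <= N.+1%:R^-1.
  rewrite -[X in `|X - _|]/(cfun_eval y _) raddf_sum /cfun_eval.
  have [[m Vm]|nV] := pselect (exists n, V n y); last first.
    rewrite big1 => [|n _]; last by apply: u0 => Vn; apply: nV; exists n.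
    rewrite /g; case: pselect => // _.
    by rewrite subrr normr0 invr_ge0.
  have u0m n : n <> m -> u n y = 0.
    by move=> nm; apply: u0 => Vn; apply: nm; exact: Vuniq Vn Vm.
  rewrite (gV _ _ Vm); have [mN|Nm] := ltnP m N.
    rewrite (bigD1 (Ordinal mN)) //= big1 ?addr0 => [|i im].
      by rewrite subrr normr0 invr_ge0.
    by apply: u0m => e; move/eqP: im; apply; exact: val_inj.
  rewrite big1 => [|i _]; last first.
    by apply: u0m => e; move: Nm; rewrite -e leqNgt ltn_ord.
  rewrite sub0r normrN (le_trans (ub _ _)) // lef_pV2 ?posrE ?ltr0n //.
  by rewrite ler_nat.
have cg : continuous g.
  move=> y; apply/cvgrPdist_lt => e e0.
  have e3 : 0 < e / 3 by rewrite divr_gt0.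
  have [N _ /(_ N (leqnn N)) NE] := near_infty_natSinv_lt (PosNum e3).
  have {NE} Ne : N.+1%:R^-1 < e / 3 := NE.
  set s := \sum_(n < N) u n.
  have /cvgrPdist_lt /(_ _ e3) : s z @[z --> y] --> s y by exact: cts_fun.
  apply: filterS => z sz.
  have third (a b c d r : R) :
    a <= d -> b < r / 3 -> c <= d -> d < r / 3 -> a + b + c < r by lra.
  apply: le_lt_trans (third _ _ _ _ _ (gN N y) sz (gN N z) Ne).
  rewrite (_ : g y - g z = - (s y - g y) + (s y - s z) + (s z - g z)); last by ring.
  apply: le_trans (ler_normD _ _) _; rewrite lerD2r.
  by apply: le_trans (ler_normD _ _) _; rewrite normrN.
by exists (mkcts cg).
Qed.

Lemma cfun_bounded (f : C) : compact [set: X] -> exists M, forall x, `|f x| <= M.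
Proof.
move=> cX; have : compact (f @` [set: X]).
  by apply: continuous_compact => //; apply: continuous_subspaceT; exact: cts_fun.
move=> /(@compact_bounded R R^o) [M [_ /(_ (M + 1))]].
by rewrite ltrDl ltr01 => /(_ isT) b; exists (M + 1) => x; apply: b; exists x.
Qed.

End ContinuousFunctions.

(** * Zero-preserving additive maps *)

Section ZeroPreserving.
Context {R : realType} {X : topologicalType}.
Local Notation C := (continuousType X R).
Implicit Type S : {additive C -> C}.

(** Additive maps are Q-linear. *)
Lemma additive_cst_rat S q : S 1 = 0 -> S (cst (ratr q)) = 0.
Proof.
move=> S1.
have e : (cst (ratr q) : C) *~ denq q = 1 *~ numq q.
  apply/continuousEP => x; rewrite -!/(cfun_eval x _) !raddfMz /cfun_eval /=.
  by rewrite -mulrzr -[ratr q]/(_ / _) divfK // intr_eq0 denq_eq0.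
have e2 : S (cst (ratr q)) *~ denq q = 0 by rewrite -raddfMz e raddfMz S1 mul0rz.
apply/continuousEP => x; apply/eqP.
have := congr1 (cfun_eval x) e2; rewrite raddfMz raddf0 => /eqP.
by rewrite mulrz_eq0 denq_eq0.
Qed.

Lemma zero_preserving_local S : zero_preserving S ->
  forall (f g : C) x, f x = g x -> S f x = S g x.
Proof.
move=> zS f g x fg; apply/eqP; rewrite -subr_eq0 -cfunNE -cfunDE -raddfB; apply/eqP.
by apply: zS; rewrite cfunDE cfunNE fg subrr.
Qed.

(** A function w that is small and supported near x can have a huge image at x.
By locality only the number w x matters, and it may be any N (f x) - q with N a
natural number and q rational: the image is then N (S f x), while a suitable q
makes w x as small as desired. *)
Lemma zero_preserving_spike S (f : C) x (V : set X) e M :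
    normal_space X -> hausdorff_space X -> zero_preserving S -> S 1 = 0 ->
    S f x != 0 -> open V -> V x -> 0 < e ->
  exists w : C, [/\ forall y, ~ V y -> w y = 0, forall y, `|w y| <= e
    & M < `|S w x|].
Proof.
move=> nX hX zS S1 Sfx oV Vx e0.
have [h [hx h0 h1]] := @bump R X V x nX hX oV Vx.
pose N := Num.Def.archi_bound (`|M| / `|S f x|).
have [q] := @rat_in_itvoo R (f x *+ N - e) (f x *+ N) ltac:(by rewrite ltrBlDr ltrDl).
rewrite in_itv /= => /andP[qlo qhi].
pose t := f x *+ N - ratr q.
have [t0 te] : 0 <= t /\ t <= e.
  by rewrite /t subr_ge0 lerBlDr addrC -lerBlDr !ltW.
exists ((cst t : C) * h); split.
- by move=> y /h0 hy; rewrite cfunME hy mulr0.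
- move=> y; rewrite cfunME normrM /= (ger0_norm t0) -[e]mulr1.
  exact: ler_pM.
- have -> : S ((cst t : C) * h) x = S f x *+ N.
    rewrite (@zero_preserving_local _ zS _ (f *+ N - (cst (ratr q) : C))); last first.
      rewrite cfunME hx mulr1 cfunDE cfunNE.
      by rewrite -[(f *+ N) x]/(cfun_eval x _) raddfMn.
    rewrite raddfB additive_cst_rat // subr0 raddfMn.
    by rewrite -[LHS]/(cfun_eval x _) raddfMn.
  rewrite normrMn -mulr_natl -ltr_pdivrMr ?normr_gt0 //.
  apply: le_lt_trans (archi_boundP _); last by rewrite divr_ge0.
  by rewrite ler_pM2r ?invr_gt0 ?normr_gt0 // ler_norm.
Qed.

(** Where S f is nonzero there would be spikes of height at most 1 / (n + 1) at
infinitely many separated points x n, with images exceeding n; their sum would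
have an unbounded image. *)
Lemma zero_preserving_killing1_eq0 S (f : C) :
    compact [set: X] -> hausdorff_space X -> perfect_set [set: X] ->
    zero_preserving S -> S 1 = 0 -> S f = 0.
Proof.
move=> cX hX pX zS S1; apply/continuousEP => p; apply: contrapT => /eqP Sfp.
pose U := [set y | S f y != 0].
have oU : open U.
  apply: (@open_comp _ _ (S f) [set r : R | r != 0]); last exact: open_neq.
  by move=> y _; exact: cts_fun.
have [x [V [oV VU Vx dV]]] := disjoint_opens hX pX oU (ex_intro _ p Sfp).
have /choice[w wP] n : exists w : C,
    [/\ forall y, ~ V n y -> w y = 0, forall y, `|w y| <= n.+1%:R^-1
      & n%:R < `|S w (x n)|].
  apply: (@zero_preserving_spike S f) => //; first exact: compact_normal.
  exact: (VU n _ (Vx n)).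
have [g gw] := glue_disjoint_bumps dV (fun n => let: And3 h _ _ := wP n in h)
  (fun n => let: And3 _ h _ := wP n in h).
have [M SgM] := cfun_bounded (S g) cX.
have [n Mn] : exists n : nat, M < n%:R.
  by exists (Num.Def.archi_bound `|M|); apply: le_lt_trans (ler_norm _) (archi_boundP _).
have [_ _] := wP n; rewrite -(zero_preserving_local zS (gw _ _ (Vx n))).
by move/(lt_trans Mn)/(le_lt_trans (SgM (x n))); rewrite ltxx.
Qed.

End ZeroPreserving.

Lemma upsilon_real_eta (R : realType) (X : topologicalType) :
  upsilon_space R X -> real_eta_space R X.
Proof.
move=> uX T Tadd Tloc; apply: uX => // f x fx.
by have [a ->] := Tloc f; rewrite cfunME fx mulr0.
Qed.

(** Subtracting the multiplication by T 1 reduces to a map that kills 1. *)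
Lemma perfect_upsilon_space (R : realType) (X : topologicalType) :
    compact [set: X] -> hausdorff_space X -> perfect_set [set: X] ->
  upsilon_space R X.
Proof.
move=> cX hX pX T Tadd zT; exists (T 1) => f.
pose D (g : continuousType X R) := T g - T 1 * g.
have Dadd : zmod_morphism D.
  move=> g h; have Tsub : T (g - h) = T g - T h.
    by rewrite -[in RHS](subrK h g) [in RHS]Tadd addrK.
  by rewrite /D Tsub mulrBr !opprD addrACA.
pose S : {additive continuousType X R -> continuousType X R} :=
  HB.pack D (GRing.isZmodMorphism.Build _ _ D Dadd).
have S1 : S 1 = 0 by rewrite /= /D mulr1 subrr.
have zS : zero_preserving S.
  by move=> g x gx; rewrite /= /D cfunDE cfunNE cfunME gx mulr0 subr0 zT.
by apply/eqP; rewrite -subr_eq0; apply/eqP/(zero_preserving_killing1_eq0 f cX hX pX zS S1).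
Qed.

(** * Isolated points *)

Lemma point_indicator (R : realType) (X : topologicalType) (x : X) :
    hausdorff_space X -> open [set x] ->
  exists e : continuousType X R, e x = 1 /\ forall y, y <> x -> e y = 0.
Proof.
move=> hX ox.
have ce : continuous (fun y => \1_[set x] y : R).
  move=> y; have [<-|xy] := eqVneq x y.
    apply: cvg_near_cst; apply: filterS (open_nbhs_nbhs (conj ox erefl)).
    by move=> z ->.
  have oC : open (~` [set x]).
    by apply: closed_openC; apply: accessible_closed_set1; exact: hausdorff_accessible.
  have yC : (~` [set x]) y by move=> /= yx; rewrite yx eqxx in xy.
  apply: cvg_near_cst; apply: filterS (open_nbhs_nbhs (conj oC yC)).
  by move=> z zC /=; rewrite !indicE !memNset.
exists (mkcts ce); split=> [|y yx].
  by change (\1_[set x] x = 1 :> R); rewrite indicE mem_set.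
by change (\1_[set x] y = 0 :> R); rewrite indicE memNset.
Qed.

(** At an isolated point x a nonlinear additive function of the number f x can be
realised by multipliers: the quotient phi (f x) / f x, extended by 0 off x, is
a continuous multiplier that depends on f. *)
Lemma real_eta_perfect (R : realType) (X : topologicalType) :
  hausdorff_space X -> real_eta_space R X -> perfect_set [set: X].
Proof.
move=> hX eX; apply/perfectTP => x ox.
have [e [ex e0]] := point_indicator R hX ox.
have [phi [phiD phi1]] := additive_retraction_onto_rat R.
have phi0 : phi 0 = 0 by apply: (addrI (phi 0)); rewrite -phiD !addr0.
pose T (f : continuousType X R) : continuousType X R :=
  (cst (ratr (phi (f x))) : continuousType X R) * e.
have [||a Ta] := eX T.
- by move=> f g; apply/continuousEP => y; rewrite /T !cfunDE !cfunME /= phiD rmorphD mulrDl.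
- move=> f; exists ((cst (ratr (phi (f x)) / f x) : continuousType X R) * e).
  apply/continuousEP => y; rewrite !cfunME /=.
  have [->|/e0 ->] := pselect (y = x); last by rewrite !mulr0 mul0r.
  have [fx|fx] := eqVneq (f x) 0; last by rewrite ex !mulr1 divfK.
  by rewrite fx phi0 rmorph0 !mul0r.
- have Tx c : ratr (phi c) = a x * c.
    have := congr1 (fun f : continuousType X R => f x) (Ta (cst c)).
    by rewrite /T !cfunME ex mulr1.
  have a1 : a x = 1 by have := Tx 1; rewrite phi1 rmorph1 mulr1.
  by apply: (@pi_irrationnal R); exists (phi pi) => //; rewrite Tx a1 mul1r.
Qed.

Theorem theorem14 (R : realType) (X : topologicalType)
    (compactX : compact [set: X]) (hausdorffX : hausdorff_space X) :
  [<-> upsilon_space R X;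
       real_eta_space R X;
       dense [set x : X | q_point x];
       isolated [set: X] = set0].
Proof.
have perfect_iff : perfect_set [set: X] <-> isolated [set: X] = set0.
  by rewrite perfectP; split=> [[]|] //; split=> //; exact: closedT.
tfae.
- exact: upsilon_real_eta.
- move=> eX; apply: perfect_q_point_dense => //.
  exact: (real_eta_perfect hausdorffX eX).
- by move=> dX; apply/perfect_iff; exact: q_point_dense_perfect.
- by move=> iX; apply: perfect_upsilon_space => //; exact/perfect_iff.
Qed.
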